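(* Let $R$ be a commutative ring with $1$ and let $I_2$ be the ideal of $R$ generated by the elements $r^2-r$, $r\in R$. The map $D:R\to I_2$, $D(r)=r^2-r$, is a universal quadratic derivation; that is, $D$ is a quadratic derivation, and for every $R$-module $M$ and every quadratic derivation $d:R\to M$ there is a unique $R$-linear map $\hat d:I_2\to M$ such that $d=\hat d\circ D$.
   Context: A quadratic derivation on $R$ with values in an $R$-module $M$ is a map $d:R\to M$ such that for all $r,s\in R$: $d(r+s)=d(r)+d(s)+rs\,d(2)$ and $d(rs)=r\,d(s)+s^2\,d(r)$. *)

(* Defs.v *)
From HB Require Import structures.
From mathcomp Require Import all_boot all_algebra.
From mathcomp Require Import boolp classical_sets.

Set Implicit Arguments.
Unset Strict Implicit.
Unset Printing Implicit Defensive.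

Import GRing.Theory.

Local Open Scope classical_set_scope.
Local Open Scope ring_scope.

(* [ring_quotient.idealr_closed] only describes proper ideals of nontrivial
   rings; here [R] may be the zero ring and an ideal may be the whole ring. *)
Definition is_ideal (R : comPzRingType) (J : set R) : Prop :=
  [/\ J 0, (forall x y, J x -> J y -> J (x + y)) &
      (forall a x, J x -> J (a * x))].

Definition ideal_gen (R : comPzRingType) (S : set R) : set R :=
  smallest (@is_ideal R) S.

Definition I2_set (R : comPzRingType) : set R :=
  ideal_gen (range (fun r : R => r ^+ 2 - r)).
Arguments I2_set : clear implicits.

Lemma ideal_gen_ideal (R : comPzRingType) (S : set R) :
  is_ideal (ideal_gen S).
Proof.
split; first by move=> J [[]].
- move=> x y Sx Sy J JP; have [[_ JD _] _] := JP.
  by apply: JD; [apply: Sx | apply: Sy].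
- move=> a x Sx J JP; have [[_ _ JM] _] := JP.
  by apply: JM; apply: Sx.
Qed.

Definition I2_pred (R : comPzRingType) : {pred R^o} :=
  fun x => x \in I2_set R.

Lemma I2_submod_closed (R : comPzRingType) : subsemimod_closed (@I2_pred R).
Proof.
have [I0 ID IM] := ideal_gen_ideal (range (fun r : R => r ^+ 2 - r)).
have I2P (x : R^o) : (x \in @I2_pred R) = (x \in I2_set R) by [].
split=> [|a x]; last by rewrite !I2P !inE; apply: IM.
by split=> [|x y]; rewrite !I2P !inE //; apply: ID.
Qed.

HB.instance Definition _ (R : comPzRingType) :=
  GRing.isSubmodClosed.Build R R^o (@I2_pred R) (@I2_submod_closed R).

(* The ideal I_2, as an R-module: a submodule of the regular module R^o. *)
Definition I2 (R : comPzRingType) : Type := {x : R^o | @I2_pred R x}.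

HB.instance Definition _ (R : comPzRingType) := SubChoice.on (I2 R).
HB.instance Definition _ (R : comPzRingType) :=
  [SubChoice_isSubLmodule of I2 R by <:].

Lemma D_subproof (R : comPzRingType) (r : R) : I2_pred (r ^+ 2 - r : R^o).
Proof. by apply/mem_set => J [_]; apply; exists r. Qed.

Definition D (R : comPzRingType) (r : R) : I2 R :=
  exist _ (r ^+ 2 - r) (D_subproof r).

Definition quadratic_derivation (R : comPzRingType) (M : lmodType R)
    (d : R -> M) : Prop :=
  (forall r s : R, d (r + s) = d r + d s + (r * s) *: d 2) /\
  (forall r s : R, d (r * s) = r *: d s + s ^+ 2 *: d r).

(* Main.v *)
Require Import Defs.
From HB Require Import structures.
From mathcomp Require Import all_boot all_algebra.
From mathcomp Require Import boolp classical_sets.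
From mathcomp Require Import ring.

(** Uniqueness holds because the elements [D r] generate the module [I2].
For existence, [dhat] has to send [\sum_i a_i D(r_i)] to
[\sum_i a_i d(r_i)], so one considers the submodule [graph d] of [I2 * M]
spanned by the pairs [(D r, d r)] and shows that it is the graph of a function.
Two facts about its elements do this.

- Symmetry ([graph_sym]): if [(u, y)] and [(v, z)] lie in [graph d] then
  [u z = v y].  For generators, this is what one gets by comparing the
  expansions of [d (r s)] and [d (s r)].
- The value of [d] on the ideal itself ([graph_d]): if [(u, y)] lies in
  [graph d] then [d u = (u - 1) y].  The formula is suggested by the case
  [d = D], where [D u = u ^ 2 - u = (u - 1) u].

Since [d 0 = 0], the second fact at [u = 0] gives [y = 0], which is the
functionality of the graph. *)

Import GRing.Theory.

Local Open Scope ring_scope.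

(** * The universal object *)

Lemma D_quadratic_derivation (R : comPzRingType) :
  quadratic_derivation (@D R).
Proof.
split=> r s; apply: val_inj => /=.
- change ((r + s) ^+ 2 - (r + s) =
    (r ^+ 2 - r) + (s ^+ 2 - s) + (r * s) * (2 ^+ 2 - 2)); ring.
- change ((r * s) ^+ 2 - r * s =
    r * (s ^+ 2 - s) + s ^+ 2 * (r ^+ 2 - r)); ring.
Qed.

(** The elements whose image satisfies [P] form an ideal containing every
[r ^+ 2 - r], so minimality of [I2_set] applies. *)
Lemma I2_gen_ind {R : comPzRingType} (P : I2 R -> Prop) :
  P 0 -> (forall u v, P u -> P v -> P (u + v)) ->
  (forall a u, P u -> P (a *: u)) -> (forall r, P (D r)) ->
  forall u, P u.
Proof.
move=> P0 PD PZ Pgen u.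
pose J : set R := fun x => exists2 v : I2 R, val v = x & P v.
have [v /val_inj <- //] : J (val u).
have := set_mem (valP u); apply; split.
- split.
  + by exists 0.
  + by move=> _ _ [v <- Pv] [w <- Pw]; exists (v + w); last exact: PD.
  + by move=> a _ [v <- Pv]; exists (a *: v); last exact: PZ.
- by move=> _ [r _ <-]; exists (D r).
Qed.

Lemma linear_ext {R : pzRingType} {U V : lmodType R} (f g : {linear U -> V}) :
  f =1 g -> f = g.
Proof.
case: f g => [f cf] [g cg] /= /funext fg; rewrite -{}fg in cg *.
congr GRing.Linear.Pack.
case: cf cg => [[a1] [b1]] [[a2] [b2]].
by rewrite (Prop_irrelevance a1 a2) (Prop_irrelevance b1 b2).
Qed.

(** * Elements of the ideal as ring elements *)

(** The projection [val] lands in the regular module [R^o]; typing its values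
in [R] lets scalar identities be normalized in a single ring. *)
Definition I2val {R : comPzRingType} (u : I2 R) : R := val u.

Section I2val.

Context {R : comPzRingType}.
Implicit Types u v : I2 R.

Lemma I2val0 : I2val (0 : I2 R) = 0. Proof. by []. Qed.
Lemma I2valD u v : I2val (u + v) = I2val u + I2val v. Proof. by []. Qed.
Lemma I2valZ a u : I2val (a *: u) = a * I2val u. Proof. by []. Qed.
Lemma I2val_gen (r : R) : I2val (D r) = r ^+ 2 - r. Proof. by []. Qed.

Definition I2valE := (I2val0, I2valD, I2valZ, I2val_gen).

End I2val.

(** * The graph of the induced map *)

Inductive graph {R : comPzRingType} {M : lmodType R} (d : R -> M) :
    I2 R -> M -> Prop :=
| graph_gen r : graph d (D r) (d r)
| graph_zero : graph d 0 0
| graph_add u v y z : graph d u y -> graph d v z -> graph d (u + v) (y + z)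
| graph_scale a u y : graph d u y -> graph d (a *: u) (a *: y).
Arguments graph_add {R M d u v y z}.
Arguments graph_scale {R M d} a {u y}.

Lemma graph_total {R : comPzRingType} {M : lmodType R} (d : R -> M) u :
  exists y, graph d u y.
Proof.
move: u; apply: I2_gen_ind => [|u v [y uy] [z vz]|a u [y uy]|r].
- by exists 0; apply: graph_zero.
- by exists (y + z); apply: graph_add.
- by exists (a *: y); apply: graph_scale.
- by exists (d r); apply: graph_gen.
Qed.

Section QuadraticDerivation.

Context {R : comPzRingType} {M : lmodType R} {d : R -> M}.
Hypothesis qd : quadratic_derivation d.

Let dD r s : d (r + s) = d r + d s + (r * s) *: d 2 := qd.1 r s.
Let dM r s : d (r * s) = r *: d s + s ^+ 2 *: d r := qd.2 r s.

Lemma qderiv0 : d 0 = 0.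
Proof. by have := dM 0 0; rewrite mulr0 expr0n /= !scale0r addr0. Qed.

(** Both sides are what remains of the two expansions of [d (r * s)] and
[d (s * r)]. *)
Lemma qderiv_sym r s : (r ^+ 2 - r) *: d s = (s ^+ 2 - s) *: d r.
Proof.
have := dM r s; rewrite mulrC dM => e.
apply/eqP; rewrite !scalerBl subr_eq addrAC eq_sym subr_eq.
by rewrite addrC -e addrC.
Qed.

Lemma graph_sym {u v y z} :
  graph d u y -> graph d v z -> I2val u *: z = I2val v *: y.
Proof.
move=> uy vz; elim: uy => {u y} [r||u u' y y' _ e _ e'|a u y _ e];
  rewrite ?I2valE.
- elim: vz => {v z} [s||v v' z z' _ e _ e'|a v z _ e];
    rewrite ?I2valE.
  + exact: qderiv_sym.
  + by rewrite scaler0 scale0r.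
  + by rewrite scalerDr e e' -scalerDl.
  + by rewrite scalerA mulrC -scalerA e scalerA.
- by rewrite scaler0 scale0r.
- by rewrite scalerDl e e' scalerDr.
- by rewrite -scalerA e !scalerA mulrC.
Qed.

Lemma graph_gen_sym {u y} s :
  graph d u y -> I2val u *: d s = (s ^+ 2 - s) *: y.
Proof. by move/graph_sym/(_ (graph_gen d s)). Qed.

(** In the additive step, the cross term [u v d(2)] is [2 u z], because
[D 2 = 2], and by symmetry this is the required [u z + v y]. *)
Lemma graph_d {u y} : graph d u y -> d (I2val u) = (I2val u - 1) *: y.
Proof.
elim=> {u y} [r||u v y z uy IHu vz IHv|a u y uy IH]; rewrite I2valE.
- (* Expand [d (r * r)] both as a product and as [d (D r + r)]. *)
  have := dD (r ^+ 2 - r) r; rewrite subrK {1}expr2 dM.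
  rewrite [(r ^+ 2 - r) * r]mulrC -[(r * (_ - _)) *: _]scalerA.
  rewrite (qderiv_sym r 2) scalerA.
  rewrite -addrA => /esym/(canRL (addrK _)) ->.
  rewrite -{3}(scale1r (d r)) -!scalerDl -scalerBl; congr (_ *: _); ring.
- by rewrite scaler0 qderiv0.
- rewrite dD IHu IHv -scalerA (graph_gen_sym 2 vz) scalerA.
  have -> : I2val u * (2 ^+ 2 - 2) = I2val u + I2val u by ring.
  rewrite [(I2val u + I2val u) *: _]scalerDl {1}(graph_sym uy vz).
  rewrite addrACA -!scalerDl scalerDr.
  by congr (_ *: _ + _ *: _); ring.
- rewrite dM IH [I2val u ^+ 2]expr2 -[(I2val u * I2val u) *: _]scalerA.
  rewrite (graph_gen_sym a uy) !scalerA -scalerDl.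
  by congr (_ *: _); ring.
Qed.

Lemma graph_fun {u y z} : graph d u y -> graph d u z -> y = z.
Proof.
move=> uy uz.
have := graph_d (graph_add uy (graph_scale (-1) uz)).
rewrite !scaleN1r subrr I2val0 qderiv0 sub0r scaleN1r => /esym/eqP.
by rewrite oppr_eq0 subr_eq0 => /eqP.
Qed.

(** The relation [graph d] need not be decidable, so the values are picked by
classical choice; functionality then makes the choice linear. *)
Lemma quadratic_derivation_factor : exists dhat : {linear I2 R -> M},
  d = dhat \o @D R.
Proof.
have [f fP] := choice (graph_total d).
have f_linear : linear f.
  move=> a u v; apply: graph_fun (fP _) _.
  by apply: graph_add (fP v); apply: graph_scale.
pose mixin := GRing.isLinear.Build R (I2 R) M *:%R f f_linear.
pose dhat : {linear I2 R -> M} := HB.pack f mixin.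
exists dhat; apply/funext => r /=.
exact: graph_fun (graph_gen d r) (fP _).
Qed.

End QuadraticDerivation.

Theorem theorem3p6 (R : comPzRingType) :
  quadratic_derivation (@D R) /\
  forall (M : lmodType R) (d : R -> M), quadratic_derivation d ->
    exists! dhat : {linear I2 R -> M}, d = dhat \o @D R.
Proof.
split=> [|M d qd]; first exact: D_quadratic_derivation.
have [f df] := quadratic_derivation_factor qd.
exists f; split=> // g; rewrite df => fg.
apply: linear_ext; apply: I2_gen_ind => [|u v fgu fgv|a u fgu|r].
- by rewrite !linear0.
- by rewrite !linearD /= fgu fgv.
- by rewrite !linearZ /= fgu.
- exact: (congr1 (fun h => h r) fg).
Qed.
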